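(* Let $G$ be a finite directed graph, $\mathcal H$ its monoid of hikes and $\mu$ the Möbius function on $\mathcal H$. For all $h\in\mathcal H$, $\Omega*\mu(h)=1_w(h)$, where $\Omega(h)$ is the number of prime factors of $h$ counted with multiplicity and $1_w$ is the indicator function over non-trivial walks.
   Context: Let $G=(V,E)$ be a finite directed graph with $V=\{v_1,\dots,v_N\}$ and $E\subseteq V^2$ (loops allowed). Each arc $(v_i,v_j)\in E$ is identified with a letter $w_{ij}$. Let $\mathcal M$ be the trace monoid generated by the arcs, i.e. the quotient of the free monoid on the arcs by the relations $w_{ij}w_{kl}=w_{kl}w_{ij}$ for $i\neq k$. The words on the arcs in the equivalence class of an element of $\mathcal M$ are called its representations. A hike is an element $h=w_{i_1j_1}\cdots w_{i_\ell j_\ell}$ of $\mathcal M$ such that for each $i$, $\#\{k: i_k=i\}=\#\{k: j_k=i\}$. The hikes form a submonoid $\mathcal H$ of $\mathcal M$, containing the empty (trivial) hike $1$. A hike is a (closed) walk if it has a contiguous representation, i.e. one in which each arc but the first starts at the vertex where the previous arc ended; it is non-trivial if it is not $1$. A simple cycle (also called a prime) is a hike of the form $w_{i_1i_2}w_{i_2i_3}\cdots w_{i_\ell i_1}$ with $\ell\ge1$ and $i_1,\dots,i_\ell$ pairwise distinct. Every hike is a product of simple cycles (its prime factors), uniquely up to exchanging consecutive vertex-disjoint simple cycles; $\Omega(h)$ is the number of factors in this product, with $\Omega(1)=0$. For $d,h\in\mathcal H$, $d\mid h$ means $h=d.h'$ for some (necessarily unique) $h'\in\mathcal H$, denoted $h/d$.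 The Dirichlet convolution of $f,g:\mathcal H\to\mathbb R$ is $f*g(h)=\sum_{d\mid h}f(d)g(h/d)$; its identity is $\delta$, with $\delta(1)=1$ and $\delta(h)=0$ for $h\ne1$. The Möbius function $\mu$ is the inverse of the constant function $1$ for $*$; explicitly, $\mu(1)=1$, $\mu(h)=(-1)^{\Omega(h)}$ if $h$ is a product of pairwise vertex-disjoint simple cycles, and $\mu(h)=0$ otherwise. *)

(* Defs.v *)
From HB Require Import structures.
From Stdlib Require Import Relation_Operators.
From mathcomp Require Import all_boot all_order all_algebra.
From mathcomp Require Import generic_quotient.
From mathcomp Require Import boolp classical_sets functions cardinality.
From mathcomp Require Import fsbigop reals.

Set Implicit Arguments.
Unset Strict Implicit.
Unset Printing Implicit Defensive.

Import GRing.Theory.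

Local Open Scope quotient_scope.

Section Trace.
Variables (V : finType) (E : {set V * V}).

Definition arc : Type := {a : V * V | a \in E}.
HB.instance Definition _ := Finite.on arc.
Definition src (a : arc) : V := (val a).1.
Definition tgt (a : arc) : V := (val a).2.

Definition word : Type := seq arc.
HB.instance Definition _ := Choice.on word.

Inductive swap : word -> word -> Prop :=
  Swap u a b v of src a != src b : swap (u ++ a :: b :: v) (u ++ b :: a :: v).

Definition word_eqv : rel word :=
  fun u v => `[< clos_refl_sym_trans word swap u v >].

Lemma word_eqv_refl : reflexive word_eqv.
Proof. by move=> u; apply/asboolP; exact: rst_refl. Qed.

Lemma word_eqv_sym : symmetric word_eqv.
Proof. by move=> u v; apply/asboolP/asboolP; exact: rst_sym. Qed.

Lemma word_eqv_trans : transitive word_eqv.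
Proof.
by move=> v u w /asboolP uv /asboolP vw; apply/asboolP; exact: rst_trans uv vw.
Qed.

Canonical word_equiv :=
  EquivRel word_eqv word_eqv_refl word_eqv_sym word_eqv_trans.

Definition trace : Type := {eq_quot word_eqv}.
HB.instance Definition _ := Choice.on trace.
HB.instance Definition _ := EqQuotient.on trace.

Lemma word_eqvP u v :
  reflect (\pi_trace u = \pi_trace v) (word_eqv u v).
Proof. by apply: (iffP idP) => /eqmodP. Qed.

Lemma word_eqv_cat u u' v v' :
  word_eqv u u' -> word_eqv v v' -> word_eqv (u ++ v) (u' ++ v').
Proof.
move=> /asboolP uu' /asboolP vv'; apply: (@word_eqv_trans (u' ++ v)).
- apply/asboolP; elim: uu' v {vv'}.
  + by move=> _ _ [w a b w' ab] v; rewrite -!catA /=; apply/rst_step/Swap.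
  + by move=> w v; exact: rst_refl.
  + by move=> w w' _ IH v; exact/rst_sym/IH.
  + by move=> w w' w'' _ IH _ IH' v; exact: rst_trans (IH v) (IH' v).
- apply/asboolP; elim: vv' => {v v' uu'}.
  + by move=> _ _ [w a b w' ab]; rewrite !catA; apply/rst_step/Swap.
  + by move=> w; exact: rst_refl.
  + by move=> w w' _ IH; exact: rst_sym.
  + by move=> w w' w'' _ IH _ IH'; exact: rst_trans IH IH'.
Qed.

Definition trace_one : trace := \pi_trace [::].
Definition trace_mul (x y : trace) : trace := \pi_trace (repr x ++ repr y).

Lemma pi_trace_mul u v :
  trace_mul (\pi_trace u) (\pi_trace v) = \pi_trace (u ++ v).
Proof. by apply/word_eqvP/word_eqv_cat; apply/word_eqvP; rewrite reprK. Qed.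

Lemma trace_mulA : associative trace_mul.
Proof.
move=> x y z; rewrite -[x]reprK -[y]reprK -[z]reprK.
move: (repr x) (repr y) (repr z) => u v w.
by rewrite (pi_trace_mul u v) (pi_trace_mul v w) !pi_trace_mul catA.
Qed.

Lemma trace_mul1 : left_id trace_one trace_mul.
Proof. by move=> x; rewrite -[x]reprK pi_trace_mul. Qed.

Lemma trace_mulr1 : right_id trace_one trace_mul.
Proof. by move=> x; rewrite -[x]reprK pi_trace_mul cats0. Qed.

HB.instance Definition _ :=
  isMonoid.Build trace trace_mulA trace_mul1 trace_mulr1.

Definition balanced_word (w : word) : bool :=
  [forall i, count (fun a => src a == i) w == count (fun a => tgt a == i) w].

Definition balanced : pred trace := fun x => balanced_word (repr x).

(* The choice of the representative is immaterial. *)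
Lemma balanced_pi w : balanced (\pi_trace w) = balanced_word w.
Proof.
suff H u v : word_eqv u v -> balanced_word u = balanced_word v.
  by apply/H/word_eqvP; rewrite reprK.
move=> /asboolP; elim=> {u v w} //.
- move=> _ _ [u a b v _]; apply: eq_forallb => i.
  by rewrite !count_cat /= (addnCA (src a == i)) (addnCA (tgt a == i)).
- by move=> u v w _ -> _ ->.
Qed.

Lemma balanced_monoid_closed : monoid_closed balanced.
Proof.
split; first by rewrite /in_mem /= balanced_pi; apply/forallP => i.
move=> x y; rewrite -[x]reprK -[y]reprK; move: (repr x) (repr y) => u v.
rewrite /in_mem /=.
rewrite [(_ * _)%g]pi_trace_mul !balanced_pi => /forallP Hu /forallP Hv.
by apply/forallP => i; rewrite !count_cat (eqP (Hu i)) (eqP (Hv i)).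
Qed.

Record hike : Type := Hike { hike_trace :> trace; _ : balanced hike_trace }.
HB.instance Definition _ := [isSub for hike_trace].
HB.instance Definition _ := [Choice of hike by <:].
HB.instance Definition _ :=
  SubChoice_isSubMonoid.Build trace balanced hike balanced_monoid_closed.

End Trace.

Section Hikes.
Variables (V : finType) (E : {set V * V}).
Local Open Scope group_scope.
Local Open Scope classical_set_scope.
Implicit Types (h d c : hike E) (w : word E).

Definition represents w h : Prop := \pi_(trace E) w = hike_trace h.

Definition follows (a b : arc E) : bool := tgt a == src b.

(* Contiguous representations of hikes are automatically closed. *)
Definition walk h : Prop := exists w, represents w h /\ sorted follows w.

Definition simple_cycle h : Prop :=
  exists w, [/\ represents w h, w != [::], cycle follows w & uniq (map (@src _ E) w)].

(* Such an [n] exists and is unique: every hike is a product of simple cycles,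
   uniquely up to exchanging consecutive vertex-disjoint ones. *)
Definition Omega h : nat :=
  xget 0%N [set n | exists s : seq (hike E),
    [/\ size s = n, {in s, forall c, simple_cycle c} & \prod_(c <- s) c = h]].

Definition hdvd d h : Prop := exists h', h = d * h'.

(* Hikes are left cancellable, so for [d] dividing [h] the set has exactly one
   element. *)
Definition hquo h d : hike E := xget 1 [set h' | h = d * h'].

End Hikes.

Section Dirichlet.
Variables (R : realType) (V : finType) (E : {set V * V}).
Local Open Scope ring_scope.
Local Open Scope classical_set_scope.
Implicit Types (f g : hike E -> R) (h d : hike E).

(* A hike has finitely many divisors (they are no longer than it), so this
   finitely-supported sum is never the default 0 of an infinite support. *)
Definition dirichlet f g h : R :=
  \sum_(d \in [set d | hdvd d h]) f d * g (hquo h d).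

Definition delta h : R := (h == 1%g)%:R.

Definition one_fct h : R := 1.

(* The inverse of the constant function 1. It is required to be two-sided since
   [dirichlet] is not commutative; it exists and is unique, because
   [one_fct 1 = 1] is invertible. *)
Definition mobius : hike E -> R :=
  xget (fun=> 0) [set m | dirichlet m one_fct = delta /\
                          dirichlet one_fct m = delta].

Definition nontrivial_walk_ind h : R := `[< walk h /\ h <> 1%g >]%:R.

End Dirichlet.

Arguments mobius {R V E}.

(* Main.v *)
(* The trace monoid is a product of free monoids, one per vertex: a trace is the
   family of its stacks, the stack of [i] listing in order the arcs leaving [i].
   Since mu is the inverse of 1, it is enough that Omega = 1_w * 1, i.e. that a
   hike has as many left divisors that are non-trivial walks as it has prime
   factors. This goes by induction on the number of factors: multiplying h on the
   right by a simple cycle c creates exactly one new walk divisor. Such a divisor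
   uses up the stacks of all vertices of c, and a walk representing it starts on
   c (follow the last exits from the vertices of c). Conversely the walk from a
   vertex v of c that pops the stacks of h.c as long as possible only gets stuck
   at v, by balance; popping from v in any divisor of h.c with full stack at v
   gives the same walk, whence uniqueness. *)

Require Import Defs.
From HB Require Import structures.
From Stdlib Require Import Relation_Operators.
From mathcomp Require Import all_boot all_order all_algebra.
From mathcomp Require Import generic_quotient.
From mathcomp Require Import boolp classical_sets functions cardinality.
From mathcomp Require Import fsbigop reals zify.
(* Again, because [arc] now denotes [path.arc]. *)
Import Defs.

Set Implicit Arguments.
Unset Strict Implicit.
Unset Printing Implicit Defensive.

Import GRing.Theory.

(** * General facts on sequences, orbits and triangular systems *)

Lemma prefix_comparable (T : eqType) (s t u : seq T) :
  prefix s u -> prefix t u -> size s <= size t -> prefix s t.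
Proof.
move=> /prefixP[s' ->]; rewrite !prefixE take_cat => /eqP tE st.
rewrite -{1}tE; case: ltnP tE => [|st' <-]; first lia.
by rewrite take_cat ltnn subnn take0 cats0.
Qed.

Lemma prefix_anti (T : eqType) (s t : seq T) :
  prefix s t -> prefix t s -> s = t.
Proof.
move=> /prefixP[u ->] /size_prefix; rewrite size_cat => le.
by rewrite (size0nil (s := u)) ?cats0 //; lia.
Qed.

Lemma path_all (T : eqType) (e : rel T) (P : pred T) (x : T) (s : seq T) :
  path e x s -> {in x :: s &, forall y z, e y z -> P y -> P z} ->
  P x -> all P s.
Proof.
elim: s x => [//|y s IHs] x /= /andP[xy ys] Pe Px.
have Py : P y by apply: Pe xy Px; rewrite !inE eqxx ?orbT.
by rewrite Py (IHs y) // => z t zs ts; apply: Pe; rewrite inE ?zs ?ts orbT.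
Qed.

(** Rotating the cycle puts an element satisfying [P] first; [P] then propagates along the resulting
    path. *)
Lemma cycle_all (T : eqType) (e : rel T) (P : pred T) (s : seq T) :
  cycle e s -> {in s &, forall x y, e x y -> P x -> P y} ->
  has P s -> all P s.
Proof.
move=> es Pe /hasP[x xs Px]; case/rot_to: (xs) => i s' sE.
have {}es : cycle e (x :: s') by rewrite -sE rot_cycle.
have sE' : s =i x :: s' by move=> y; rewrite -sE mem_rot.
rewrite (eq_all_r sE'); have := path_all es _ Px.
rewrite all_rcons; apply=> y z.
by rewrite 2!inE !mem_rcons !(orbA, orbb) -!in_cons -!sE'; exact: Pe.
Qed.

Lemma has_split_last (T : Type) (p : pred T) (s : seq T) : has p s ->
  exists s1 x s2, [/\ s = s1 ++ x :: s2, p x & ~~ has p s2].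
Proof.
elim: s => //= x s IHs.
have [/IHs[s1 [y [s2 [-> py ps2]]]] _|ps] := boolP (has p s).
  by exists (x :: s1), y, s2.
by rewrite orbF => px; exists [::], x, s.
Qed.

(* A point of [A] of minimal order under [f] has the same order as its image,
   hence lies on a cycle of [f]. *)
Lemma order_min_cycle (T : finType) (f : T -> T) (A : pred T) (x0 : T) :
  A x0 -> (forall x, A x -> A (f x)) ->
  exists2 x, A x & fcycle f (fingraph.orbit f x).
Proof.
move=> Ax0 Af; case: (arg_minnP (fingraph.order f) Ax0) => x Ax xmin.
exists x => //; apply/(orbitPcycle 0%N 1%N)/eqP.
rewrite eqn_leq xmin ?Af // andbT.
apply: subset_leq_card; apply/fintype.subsetP => y; rewrite !inE.
exact/connect_trans/fconnect1.
Qed.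

(** The equations are triangular with respect to [mu], hence solved by recursion on it. This yields
    the one-sided inverses of [one_fct]. *)
Lemma triangular_solution (R : zmodType) (T : eqType) (mu : T -> nat)
    (L : T -> seq T) (b : T -> R) :
  (forall x y, y \in L x -> mu y < mu x) ->
  exists m, forall x, m x = (b x - \sum_(y <- L x) m y)%R.
Proof.
move=> Lmu.
pose F := fix F n x {struct n} : R :=
  if n is n'.+1 then (b x - \sum_(y <- L x) F n' y)%R else 0%R.
have FE n k x : mu x < n -> mu x < k -> F n x = F k x.
  elim: n k x => // n IHn [//|k] x xn xk /=; congr (_ - _)%R.
  by apply: eq_big_seq => y /Lmu yx; apply: IHn; lia.
exists (fun x => F (mu x).+1 x) => x /=; congr (_ - _)%R.
by apply: eq_big_seq => y /Lmu yx; apply: (FE _ (mu y).+1).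
Qed.

(** * Words and their stacks *)

Section Words.
Variables (V : finType) (E : {set V * V}).
Implicit Types (u v w : word E) (i j x y : V).

Definition stack i w : seq (arc E) := [seq a <- w | src a == i].

Lemma stack_cat i u v : stack i (u ++ v) = stack i u ++ stack i v.
Proof. exact: filter_cat. Qed.

Lemma size_stack i w : size (stack i w) = count (fun a => src a == i) w.
Proof. exact: size_filter. Qed.

Definition indeg i w : nat := count (fun a => tgt a == i) w.

Lemma indeg_cat i u v : indeg i (u ++ v) = indeg i u + indeg i v.
Proof. exact: count_cat. Qed.

Lemma balanced_wordP w :
  reflect (forall i, size (stack i w) = indeg i w) (balanced_word w).
Proof.
apply: (iffP forallP) => H i; first by rewrite size_stack (eqP (H i)).
by rewrite -size_stack H.
Qed.

Lemma word_eqv_cons a u v : word_eqv u v -> word_eqv (a :: u) (a :: v).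
Proof.
by apply: (@word_eqv_cat _ _ [:: a] [:: a]); exact: word_eqv_refl.
Qed.

(** A swap exchanges arcs with distinct sources, at most one of which lies in a given stack. *)
Lemma word_eqv_stack u v : word_eqv u v -> forall i, stack i u = stack i v.
Proof.
move=> /asboolP uv i; elim: uv => {u v} //.
- move=> _ _ [u a b v ab]; rewrite !stack_cat /=.
  case: (src a =P i) ab => [->|]; case: (src b =P i) => [->|] //.
  by rewrite eqxx.
- by move=> u v w _ -> _ ->.
Qed.

Lemma word_eqv_perm u v : word_eqv u v -> perm_eq u v.
Proof.
move=> /asboolP; elim=> {u v} //.
- move=> _ _ [u a b v ab]; rewrite perm_cat2l.
  by rewrite (perm_catCA [:: a] [:: b] v).
- by move=> u v _; rewrite perm_sym.
- by move=> u v w _ uv _ ; exact: perm_trans.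
Qed.

Lemma word_eqv_front u a v : all (fun b => src b != src a) u ->
  word_eqv (u ++ a :: v) (a :: u ++ v).
Proof.
elim: u => [|b u IHu] /= => [_|/andP[ba au]]; first exact: word_eqv_refl.
apply: word_eqv_trans (word_eqv_cons b (IHu au)) _.
by apply/asboolP/rst_step/(@Swap _ _ [::]).
Qed.

(** Induction on [u]: its first arc heads a stack of [w], so no earlier arc of [w] has the same
    source and this arc commutes to the front of [w]. *)
Lemma prefix_stack_split u w :
  (forall i, prefix (stack i u) (stack i w)) -> exists v, word_eqv w (u ++ v).
Proof.
elim: u w => [w _|a u IHu w uw]; first by exists w; exact: word_eqv_refl.
have: has (fun b => src b == src a) w.
  have := size_prefix (uw (src a)); rewrite /= eqxx /= has_count -size_stack.
  exact: leq_trans.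
move=> /split_find; move: (take _ _) (drop _ _) => w1' w2' spec.
case: spec uw => b w1 w2 /eqP ba; rewrite -all_predC cat_rcons => w1a uw.
have w1s : stack (src a) w1 = [::].
  by apply/eqP; rewrite -[_ == _]negbK -has_filter -all_predC.
have eab : a = b.
  have := uw (src a).
  by rewrite stack_cat w1s /= eqxx ba eqxx /= => /andP[/eqP].
rewrite -eab in ba uw *.
have ww : word_eqv (w1 ++ a :: w2) (a :: w1 ++ w2) by exact: word_eqv_front.
have [i|v wv] := IHu (w1 ++ w2).
  have := uw i; rewrite (word_eqv_stack ww) /=.
  by case: eqP => //= _; rewrite eqxx.
by exists v; apply: word_eqv_trans ww _; exact: word_eqv_cons.
Qed.

(** By [prefix_stack_split], [v] is equivalent to [u] followed by a remainder; a first arc of the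
    remainder would lengthen one stack. *)
Lemma stack_eqv u v : (forall i, stack i u = stack i v) -> word_eqv u v.
Proof.
move=> uv; have [i|[|a w] vu] := @prefix_stack_split u v.
- by rewrite uv prefix_refl.
- by rewrite cats0 in vu; rewrite word_eqv_sym.
have /eqP := word_eqv_stack vu (src a).
rewrite (stack_cat (src a) u (a :: w)) uv -{1}[stack _ v]cats0.
by rewrite eqseq_cat // eqxx /= eqxx.
Qed.

Lemma prefix_indeg i u w :
  (forall j, prefix (stack j u) (stack j w)) -> indeg i u <= indeg i w.
Proof.
move=> /prefix_stack_split[v /word_eqv_perm wv].
by rewrite /indeg (permP wv) count_cat leq_addr.
Qed.

Lemma prefix_stack_size u w :
  (forall j, prefix (stack j u) (stack j w)) -> size u <= size w.
Proof.
move=> /prefix_stack_split[v /word_eqv_perm /perm_size ->].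
by rewrite size_cat leq_addr.
Qed.

(** The starting vertex is explicit, so that the empty word also has an end and concatenations split
    without case analysis. *)
Fixpoint trail x w : bool :=
  if w is a :: w' then (src a == x) && trail (tgt a) w' else true.

Fixpoint trail_end x w : V := if w is a :: w' then trail_end (tgt a) w' else x.

Lemma trail_cat x u v :
  trail x (u ++ v) = trail x u && trail (trail_end x u) v.
Proof. by elim: u x => //= a u IHu x; rewrite IHu andbA. Qed.

Lemma trail_end_cat x u v :
  trail_end x (u ++ v) = trail_end (trail_end x u) v.
Proof. by elim: u x => /=. Qed.

Lemma trail_sorted a w :
  trail (src a) (a :: w) = sorted (@follows _ _) (a :: w).
Proof.
rewrite /= eqxx /=; elim: w a => //= b w IHw a.
by rewrite IHw /follows eq_sym.
Qed.

(** Each visit to [i] is an arrival and a departure, except that the start lacks the arrival and the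
    end lacks the departure. *)
Lemma trail_flow x w i : trail x w ->
  size (stack i w) + (trail_end x w == i) = indeg i w + (x == i).
Proof.
rewrite size_stack; elim: w x => //= a w IHw x /andP[/eqP <- /IHw].
rewrite /indeg /=; lia.
Qed.

Lemma trail_closed x w : trail x w -> balanced_word w -> trail_end x w = x.
Proof.
move=> /(trail_flow x) wx /balanced_wordP w0; apply/eqP.
by move: wx; rewrite w0 eqxx; case: eqP => //=; lia.
Qed.

Lemma closed_trail_balanced x w :
  trail x w -> trail_end x w = x -> balanced_word w.
Proof.
move=> wx wE; apply/balanced_wordP => i; have := trail_flow i wx.
rewrite wE; lia.
Qed.

(* Popping the stacks of [e] from [x], one can only get stuck at [x], since [e]
   is balanced; until then, the pops agree with those from [g]. *)
Lemma trail_prefix x w e g : trail x w -> balanced_word e ->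
  (forall i, prefix (stack i w) (stack i g)) ->
  (forall i, prefix (stack i e) (stack i g)) ->
  size (stack x w) <= size (stack x e) ->
  forall i, prefix (stack i w) (stack i e).
Proof.
move=> wx /balanced_wordP eb + eg; elim/last_ind: w wx => [_ _ _ i|w a IHw].
  exact: prefix0s.
rewrite -cats1 trail_cat /= andbT => /andP[wx /eqP aw] wag we i.
have wg j : prefix (stack j w) (stack j g).
  apply: (@catl_prefix _ _ _ (stack j [:: a])).
  by rewrite -stack_cat; exact: wag.
have {}IHw : forall j, prefix (stack j w) (stack j e).
  by apply: IHw => //; apply: leq_trans we; rewrite stack_cat size_cat leq_addr.
(* Both are prefixes of the same stack of [g], so only lengths matter. *)
apply: prefix_comparable (wag i) (eg i) _.
rewrite stack_cat size_cat /=; case: eqP => [ai|_] /=; last first.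
  by rewrite addn0 size_prefix.
(* Here [i] is the source of the new arc. If [i] is not [x], the trail [w] has entered [i] once more
   than it left it, and [e] leaves [i] as often as it enters it, so [e] has a further arc there. If
   [i] is [x], the bound [we] concludes. *)
have := prefix_indeg i IHw; rewrite -eb; have := trail_flow i wx.
rewrite -aw ai eqxx; move: we; rewrite stack_cat size_cat /= ai.
have := size_prefix (IHw i).
by case: (x =P i) => [->|_]; rewrite ?eqxx /=; lia.
Qed.

Lemma full_trail x g : balanced_word g -> exists w,
  [/\ trail x w, trail_end x w = x, forall i, prefix (stack i w) (stack i g)
    & stack x w = stack x g].
Proof.
move=> /balanced_wordP gb.
(* It suffices to get stuck, with the stack of the current vertex exhausted: the flow equation and
   the balance of [g] force that vertex to be [x]. *)
suff [w [wx wg ws]] : exists w, [/\ trail x w,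
    forall i, prefix (stack i w) (stack i g)
    & size (stack (trail_end x w) w) = size (stack (trail_end x w) g)].
  have wE : trail_end x w = x.
    have := prefix_indeg (trail_end x w) wg; rewrite -gb -ws.
    have := trail_flow (trail_end x w) wx; rewrite eqxx.
    by case: eqP => //=; lia.
  exists w; split=> //; rewrite wE in ws.
  have /prefixP[s sE] := wg x; move/eqP: ws.
  rewrite sE size_cat -{1}[size (stack x w)]addn0 eqn_add2l eq_sym size_eq0.
  by move=> /eqP ->; rewrite cats0.
have step w : trail x w -> (forall i, prefix (stack i w) (stack i g)) ->
    size (stack (trail_end x w) w) = size (stack (trail_end x w) g) \/
    exists a, trail x (w ++ [:: a]) /\
      forall i, prefix (stack i (w ++ [:: a])) (stack i g).
  move=> wx wg; have /prefixP[[|a s] sE] := wg (trail_end x w).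
    by left; rewrite sE cats0.
  have : a \in stack (trail_end x w) g by rewrite sE mem_cat mem_head orbT.
  rewrite mem_filter => /andP[/eqP aE _].
  right; exists a; split=> [|i]; first by rewrite trail_cat wx /= aE eqxx.
  rewrite stack_cat /=; case: eqP => [<-|_]; last by rewrite cats0.
  by rewrite aE sE -[a :: s]cat1s catA prefix_prefix.
(* [n] bounds the number of arcs still to be popped; a trail within the stacks of [g] is no longer
   than [g]. *)
suff H n w : size g < size w + n -> trail x w ->
    (forall i, prefix (stack i w) (stack i g)) ->
  exists w, [/\ trail x w, forall i, prefix (stack i w) (stack i g)
    & size (stack (trail_end x w) w) = size (stack (trail_end x w) g)].
  by apply: (H (size g).+1 [::]) => // i; exact: prefix0s.
elim: n w => [|n IHn] w gw wx wg.
  by have := prefix_stack_size wg; lia.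
have [ws|[a [wax wag]]] := step w wx wg; first by exists w.
by apply: IHn wax wag; rewrite size_cat /= addn1 addSnnS.
Qed.
End Words.

(** * Hikes *)

Section HikeTheory.
Variables (V : finType) (E : {set V * V}).
Implicit Types (u v w : word E) (i j : V) (h d c x y z : hike E).
Local Open Scope group_scope.
Local Open Scope quotient_scope.

Definition hword h : word E := repr (hike_trace h).

Definition hstack i h := stack i (hword h).

Definition hlen h := size (hword h).

Lemma represents_hword h : represents (hword h) h.
Proof. exact: reprK. Qed.

Lemma represents_eqv w h : represents w h <-> word_eqv w (hword h).
Proof.
by rewrite /represents -{1}[hike_trace h]reprK; split=> /word_eqvP.
Qed.

Lemma hstackE w h i : represents w h -> stack i w = hstack i h.
Proof. by move=> /represents_eqv /word_eqv_stack. Qed.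

Lemma hlenE w h : represents w h -> hlen h = size w.
Proof. by move=> /represents_eqv /word_eqv_perm /perm_size. Qed.

Lemma represents_balanced w h : represents w h -> balanced_word w.
Proof. by rewrite /represents => wh; rewrite -balanced_pi wh; case: h {wh}. Qed.

Lemma represents_ex w : balanced_word w -> exists h, represents w h.
Proof. by rewrite -balanced_pi => wb; exists (Hike wb). Qed.

Lemma representsM u v x y :
  represents u x -> represents v y -> represents (u ++ v) (x * y).
Proof.
rewrite /represents => ux vy; rewrite -pi_trace_mul ux vy.
by [].
Qed.

Lemma represents1 : represents [::] (1 : hike E).
Proof. by []. Qed.

Lemma hike_ext x y : (forall i, hstack i x = hstack i y) -> x = y.
Proof.
move=> /stack_eqv /represents_eqv xy; apply: val_inj => /=.
by rewrite -xy; exact/esym/represents_hword.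
Qed.

Lemma hstackM i x y : hstack i (x * y) = hstack i x ++ hstack i y.
Proof.
rewrite -(hstackE i (representsM (represents_hword x) (represents_hword y))).
exact: stack_cat.
Qed.

Lemma hstack1 i : hstack i (1 : hike E) = [::].
Proof. by rewrite -(hstackE i represents1). Qed.

Lemma hlenM x y : hlen (x * y) = hlen x + hlen y.
Proof.
rewrite (hlenE (representsM (represents_hword x) (represents_hword y))).
exact: size_cat.
Qed.

Lemma hlen1 : hlen 1 = 0. Proof. by rewrite (hlenE represents1). Qed.

Lemma hlen_eq0 h : (hlen h == 0) = (h == 1).
Proof.
apply/eqP/eqP => [/size0nil h0|->]; last exact: hlen1.
by apply: hike_ext => i; rewrite hstack1 /hstack h0.
Qed.

Lemma hike_mulgI x : injective (fun y => x * y).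
Proof.
move=> y z /= yz; apply: hike_ext => i; have := hstackM i x y.
by rewrite yz hstackM => /eqP; rewrite eqseq_cat // eqxx => /eqP.
Qed.

(** A prefix of the stacks leaves a remainder that is again a hike, the balance of [d] being
    subtracted from that of [h]. *)
Lemma hdvdP d h :
  hdvd d h <-> forall i, prefix (hstack i d) (hstack i h).
Proof.
split=> [[h' ->] i|dh]; first by rewrite hstackM prefix_prefix.
have [w hw] := prefix_stack_split dh.
have hb := represents_balanced (represents_hword h).
have db := represents_balanced (represents_hword d).
have wh : represents (hword d ++ w) h.
  by apply/represents_eqv; rewrite word_eqv_sym.
have [h' wh'] : exists h', represents w h'.
  apply: represents_ex; apply/balanced_wordP => i.
  have /balanced_wordP/(_ i) := represents_balanced wh.
  rewrite stack_cat size_cat indeg_cat.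
  by have /balanced_wordP/(_ i) -> := db; exact: addnI.
exists h'; apply: hike_ext => i.
by rewrite hstackM -(hstackE i wh) stack_cat (hstackE i wh').
Qed.

Lemma hdvd_anti d h : hdvd d h -> hdvd h d -> d = h.
Proof.
move=> /hdvdP dh /hdvdP hd; apply: hike_ext => i; exact: prefix_anti.
Qed.

Lemma hdvd_trans x y z : hdvd x y -> hdvd y z -> hdvd x z.
Proof. by move=> [a ->] [b ->]; exists (a * b); rewrite mulgA. Qed.

Lemma nontrivial_walkP h : (walk h /\ h <> 1) <->
  h <> 1 /\ exists i w, represents w h /\ trail i w.
Proof.
split=> [[[[|a w] [wh]]]|[h1 [i [w [wh wx]]]]].
- by move=> _ []; apply: hike_ext => i; rewrite -(hstackE i wh) hstack1.
- by rewrite -trail_sorted => wa h1; split=> //; exists (src a), (a :: w).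
- split=> //; exists w; split=> //.
  case: w wx {wh} => // a w; rewrite -trail_sorted /= => /andP[_].
  by rewrite eqxx.
Qed.

Lemma stack_uniq w a : uniq (map (@src _ E) w) -> a \in w ->
  stack (src a) w = [:: a].
Proof.
elim: w => //= b w IHw /andP[bw wu]; rewrite inE; case: eqP => [-> _|_ /= aw].
  rewrite eqxx; congr cons; apply/eqP; rewrite -[_ == _]negbK -has_filter.
  by apply: contra bw => /hasP[d dw /eqP <-]; exact: map_f.
case: eqP bw => [->|_ _]; last exact: IHw.
by rewrite map_f.
Qed.

Lemma stack_notin w i : i \notin map (@src _ E) w -> stack i w = [::].
Proof.
move=> iw; apply/eqP; rewrite -[_ == _]negbK -has_filter.
by apply: contra iw => /hasP[d dw /eqP <-]; exact: map_f.
Qed.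

End HikeTheory.

(** * Divisors that are walks *)

Section WalkDivisors.
Variables (V : finType) (E : {set V * V}).
Implicit Types (u v w : word E) (i j : V) (h d c x y z : hike E).
Local Open Scope group_scope.

Lemma hstack_src i h a : a \in hstack i h -> src a = i.
Proof. by rewrite mem_filter => /andP[/eqP]. Qed.

(** By balance, a vertex that is entered is also left. *)
Lemma hstack_tgt i h a : a \in hstack i h -> hstack (tgt a) h != [::].
Proof.
rewrite mem_filter => /andP[_ ah]; rewrite -size_eq0.
have /balanced_wordP -> := represents_balanced (represents_hword h).
by rewrite -lt0n -has_count; apply/hasP; exists a.
Qed.

(** * Multiplication on the right by a simple cycle *)

Section RightCycle.
Variables (h c : hike E) (wc : word E).
Hypotheses (wcc : represents wc c) (wc0 : wc != [::])
  (wc_cycle : path.cycle (@follows _ _) wc)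
  (wc_uniq : uniq (map (@src _ E) wc)).

Local Notation supp := (map (@src _ E) wc).

Lemma cycle_hstack a : a \in wc ->
  hstack (src a) (h * c) = rcons (hstack (src a) h) a.
Proof.
by move=> ac; rewrite hstackM -(hstackE _ wcc) stack_uniq // cats1.
Qed.

Lemma notin_cycle_hstack i : i \notin supp -> hstack i (h * c) = hstack i h.
Proof.
by move=> ic; rewrite hstackM -(hstackE _ wcc) stack_notin // cats0.
Qed.

Lemma cycle_tgt a : a \in wc -> tgt a \in supp.
Proof.
move=> ac; have /eqP -> := next_cycle wc_cycle ac.
by apply: map_f; rewrite mem_next.
Qed.

(** Let [r] be the cofactor of [d]. If [r] leaves a vertex of the cycle, its last arc there is the
    arc of the cycle, so by balance [r] also leaves the next vertex. Going round, [r] contains all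
    of the cycle, and [d] divides [h]. *)
Lemma new_divisor_full d : hdvd d (h * c) -> ~ hdvd d h ->
  {in wc, forall a, hstack (src a) d = hstack (src a) (h * c)}.
Proof.
move=> [r hE] /hdvdP /existsNP[i /negP di].
pose P (a : arc E) := hstack (src a) r != [::].
have hr a : a \in wc ->
    rcons (hstack (src a) h) a = hstack (src a) d ++ hstack (src a) r.
  by move=> ac; rewrite -cycle_hstack // hE hstackM.
suff: ~~ has P wc.
  rewrite -all_predC => /allP rP a ac; have /= := rP a ac.
  by rewrite negbK hE hstackM => /eqP ->; rewrite cats0.
apply/negP => /(cycle_all wc_cycle) PP.
have {}PP : all P wc.
  apply: PP => a b ac bc; rewrite /follows /P => /eqP <-.
  case/lastP rE: (hstack (src a) r) => [//|r' a'] _.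
  have := hr a ac; rewrite rE -rcons_cat => /rcons_inj[_ aE].
  by apply: (@hstack_tgt (src a)); rewrite rE -aE mem_rcons mem_head.
have [/mapP[a ac ia]|ic] := boolP (i \in supp).
  move/allP/(_ a ac): PP; rewrite /P.
  case/lastP rE: (hstack (src a) r) => [//|r' a'] _.
  have := hr a ac; rewrite rE -rcons_cat => /rcons_inj[hE' _].
  by move: di; rewrite ia hE' prefix_prefix.
by move: di; rewrite -(notin_cycle_hstack ic) hE hstackM prefix_prefix.
Qed.

(** The last arc of [w] leaving the cycle's vertices ends a full stack, so it is an arc of the cycle
    and leads back to the cycle. Nothing can follow it, and the walk is closed. *)
Lemma new_walk_start d w i : represents w d -> trail i w ->
  hdvd d (h * c) -> ~ hdvd d h -> i \in supp.
Proof.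
move=> wd wi dhc dh; have dfull := new_divisor_full dhc dh.
have wfull a : a \in wc -> stack (src a) w = rcons (hstack (src a) h) a.
  by move=> ac; rewrite (hstackE _ wd) dfull // cycle_hstack.
have : has (fun b => src b \in supp) w.
  case: wc wc0 wfull => // a s _ wfull; apply/hasP; exists a.
    have: a \in stack (src a) w.
      by rewrite wfull ?mem_head // mem_rcons mem_head.
    by rewrite mem_filter => /andP[].
  by rewrite mem_head.
case/has_split_last => w1 [b [w2 [wE /mapP[a ac ba] /hasPn w2c]]].
have ab : a = b.
  have := wfull a ac; rewrite wE stack_cat /= -ba eqxx.
  rewrite -[stack _ w2]/(stack (src b) w2).
  have -> : stack (src b) w2 = [::].
    apply/eqP; rewrite -[_ == _]negbK -has_filter; apply/hasPn => e /w2c.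
    by apply: contra => /eqP ->; rewrite ba map_f.
  by rewrite cats1 => /rcons_inj[_ ->].
have iE := trail_closed wi (represents_balanced wd).
move: wi iE; rewrite wE trail_cat trail_end_cat /= => /and3P[_ _].
case: w2 w2c {wE} => [_ _ <-|e w2 w2c] /=; first by rewrite -ab cycle_tgt.
move=> /andP[/eqP eb _]; have := w2c e (mem_head _ _).
by rewrite eb -ab cycle_tgt.
Qed.

(** Such a walk starts on the cycle, where both divisors have full stacks; [trail_prefix] then shows
    that each divides the other. *)
Lemma new_walk_unique d e : walk d -> walk e -> d <> 1 -> e <> 1 ->
  hdvd d (h * c) -> ~ hdvd d h -> hdvd e (h * c) -> ~ hdvd e h -> d = e.
Proof.
suff le x y : walk x -> x <> 1 ->
    hdvd x (h * c) -> ~ hdvd x h -> hdvd y (h * c) -> ~ hdvd y h -> hdvd x y.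
  by move=> *; apply: hdvd_anti; exact: le.
move: x y => {}d {}e wd d1 dhc dh ehc eh.
have [_ [i [w [{}wd wi]]]] : d <> 1 /\ exists i w, represents w d /\ trail i w.
  exact/nontrivial_walkP.
have ic := new_walk_start wd wi dhc dh; have /mapP[a ac ia] := ic.
apply/hdvdP => j; rewrite -(hstackE _ wd).
have /hdvdP dS := dhc; have /hdvdP eS := ehc.
apply: (trail_prefix (g := hword (h * c)) wi) => [|k|//|].
- exact: represents_balanced (represents_hword e).
- by rewrite (hstackE _ wd); exact: dS.
rewrite (hstackE _ wd) -/(hstack _ e) ia new_divisor_full //.
by rewrite -(new_divisor_full ehc eh).
Qed.

(** The full trail of [h * c] from a vertex of the cycle exhausts a stack that is one longer than in
    [h]. *)
Lemma new_walk_ex : exists d,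
  [/\ walk d, d <> 1, hdvd d (h * c) & ~ hdvd d h].
Proof.
have [a ac] : exists a, a \in wc.
  by case: wc wc0 => // a s _; exists a; exact: mem_head.
have hcb := represents_balanced (represents_hword (h * c)).
have [w [wx wE wS wfull]] := full_trail (src a) hcb.
have [d wd] := represents_ex (closed_trail_balanced wx wE).
have dh : ~ hdvd d h.
  move=> /hdvdP/(_ (src a))/size_prefix; rewrite -(hstackE _ wd) wfull.
  by rewrite -/(hstack _ _) cycle_hstack // size_rcons ltnn.
have d1 : d <> 1 by move=> d1; apply: dh; rewrite d1; exists h; rewrite mul1g.
exists d; split=> //; last by apply/hdvdP => i; rewrite -(hstackE _ wd).
by apply: (proj1 (proj2 (nontrivial_walkP d) _)); split=> //; exists (src a), w.
Qed.
End RightCycle.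

Lemma simple_cycle_walks h c : simple_cycle c -> exists d, [/\ ~ hdvd d h &
  forall x, (walk x /\ x <> 1) /\ hdvd x (h * c) <->
            x = d \/ (walk x /\ x <> 1) /\ hdvd x h].
Proof.
move=> [wc [wcc wc0 wcy wcu]].
have [d [dw d1 dhc dh]] := new_walk_ex h wcc wc0 wcu.
exists d; split=> // x; split=> [[[xw x1] xhc]|[->//|[? xh]]].
- have [xh|xh] := pselect (hdvd x h); [by right|left].
  exact: (new_walk_unique wcc wc0 wcy wcu xw dw x1 d1 xhc xh dhc dh).
- by split=> //; apply: hdvd_trans xh _; exists c.
Qed.
End WalkDivisors.

(** * Factorization into simple cycles *)

Section Factorization.
Variables (V : finType) (E : {set V * V}).
Implicit Types (w : word E) (h c : hike E).
Local Open Scope group_scope.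

Lemma cycle_balanced w : path.cycle (@follows _ _) w -> balanced_word w.
Proof.
case: w => [_|a s]; first by apply/balanced_wordP.
rewrite /= rcons_path => /andP[aS /eqP sE].
apply: (@closed_trail_balanced _ _ (src a)); first by rewrite trail_sorted.
by rewrite -sE /=; elim: s a {aS sE} => //=.
Qed.

(** From each vertex with a non-empty stack, follow the first arc of that stack. By balance this
    never stops, so it runs into a cycle; the arcs of that cycle head their stacks, so it divides
    [h] on the left. *)
Lemma simple_cycle_factor h : h <> 1 ->
  exists c h', simple_cycle c /\ h = c * h'.
Proof.
move=> h1; case hE: (hword h) => [|a0 s0].
  by case: h1; apply/eqP; rewrite -hlen_eq0 /hlen hE.
(* The default [a0] only serves vertices with an empty stack, which lie outside [A]. *)
pose first i := head a0 (hstack i h).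
pose A : pred V := fun i => hstack i h != [::].
have first_in i : A i -> first i \in hstack i h.
  by rewrite /A /first; case: (hstack i h) => // a s _; exact: mem_head.
have Af i : A i -> A (tgt (first i)) by move=> /first_in /hstack_tgt.
have Aa0 : A (src a0) by rewrite /A /hstack hE /= eqxx.
have [x Ax xcyc] := order_min_cycle Aa0 Af.
set o := fingraph.orbit _ x in xcyc.
have Ao i : i \in o -> A i.
  rewrite -fconnect_orbit => /iter_findex <-.
  by elim: (findex _ _ _) => //= n; exact: Af.
have src_first i : i \in o -> src (first i) = i.
  by move=> /Ao /first_in /hstack_src.
pose wc : word E := [seq first i | i <- o].
have srcwc : map (@src _ E) wc = o.
  by rewrite -map_comp -[RHS]map_id; apply/eq_in_map => i; exact: src_first.
have uo : uniq o by exact: orbit_uniq.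
have wccyc : path.cycle (@follows _ _) wc.
  rewrite cycle_map; move: xcyc; apply: sub_in_cycle (allss o) => i j io jo.
  by rewrite /= /follows src_first.
have [c wcc] : exists c, represents wc c.
  exact/represents_ex/cycle_balanced.
have [h' hE'] : hdvd c h.
  apply/hdvdP => i; rewrite -(hstackE _ wcc).
  have [io|io] := boolP (i \in o); last by rewrite stack_notin ?srcwc ?prefix0s.
  have := stack_uniq (w := wc) (a := first i).
  rewrite srcwc src_first // => -> //.
    move: (Ao _ io); rewrite /A /first; case: (hstack i h) => // a s _.
    by rewrite /= eqxx prefix0s.
  exact: map_f.
exists c, h'; split=> //; exists wc; split; rewrite ?srcwc //.
have : first x \in wc by apply: map_f; rewrite -fconnect_orbit connect0.
by case: (wc).
Qed.

Lemma simple_cycle_neq1 c : simple_cycle c -> c <> 1.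
Proof.
move=> [w [wc w0 _ _]] c1; move/eqP: c1; rewrite -hlen_eq0 (hlenE wc).
by rewrite size_eq0 (negPf w0).
Qed.

Lemma simple_cycle_factorization h : exists s : seq (hike E),
  {in s, forall c, simple_cycle c} /\ \prod_(c <- s) c = h.
Proof.
have [n] := ubnP (hlen h); elim: n h => // n IHn h.
have [->|/eqP h1] := eqVneq h 1; first by exists [::]; rewrite big_nil.
have [c [h' [cc ->]]] := simple_cycle_factor h1.
have c0 : 0 < hlen c by rewrite lt0n hlen_eq0; apply/eqP/simple_cycle_neq1.
rewrite hlenM => hn; have [|s [sc sE]] := IHn h'; first lia.
exists (c :: s); rewrite big_cons sE; split=> // d.
by rewrite inE => /predU1P[->|/sc].
Qed.

(** Existence of a factorization excludes the default value in [Omega]. *)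
Lemma OmegaP h : exists s : seq (hike E), [/\ size s = Omega h,
  {in s, forall c, simple_cycle c} & \prod_(c <- s) c = h].
Proof.
have [s [sc sE]] := simple_cycle_factorization h.
apply: (@xgetPex _ 0 [set n | exists s : seq (hike E), [/\ size s = n,
  {in s, forall c, simple_cycle c} & \prod_(c <- s) c = h]]%classic).
by exists (size s), s.
Qed.

End Factorization.

(** * Dirichlet convolution *)

Section DirichletTheory.
Variables (R : realType) (V : finType) (E : {set V * V}).
Implicit Types (f g k : hike E -> R) (h d x y : hike E).
Local Open Scope ring_scope.
Local Open Scope quotient_scope.

(** Repetitions occur, one for each word of a trace; [factor_pairs] removes them. *)
Definition hikes_upto n : seq (hike E) :=
  pmap insub [seq \pi_(trace E) (bseqval b : word E) |
    b <- enum {: n.-bseq (arc E)}].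

Lemma mem_hikes_upto n h : (hlen h <= n)%N -> h \in hikes_upto n.
Proof.
move=> hn; rewrite mem_pmap; apply/mapP; exists (hike_trace h); last first.
  exact: (esym (valK h)).
apply/mapP; exists (Bseq hn); rewrite ?mem_enum //=.
exact/esym/represents_hword.
Qed.

(** Pairs treat both factors alike and avoid [hquo]. Lengths add up, so factors no longer than [h]
    suffice. *)
Definition factor_pairs h : seq (hike E * hike E) :=
  let s := hikes_upto (hlen h) in
  undup [seq p <- [seq (d, x) | d <- s, x <- s] | (p.1 * p.2)%g == h].

Lemma factor_pairs_uniq h : uniq (factor_pairs h).
Proof. exact: undup_uniq. Qed.

Lemma mem_factor_pairs h p : (p \in factor_pairs h) = ((p.1 * p.2)%g == h).
Proof.
rewrite mem_undup mem_filter; case: eqP => //= <-.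
apply/allpairsP; exists p; case: p => d x /=.
by split=> //; apply: mem_hikes_upto; rewrite hlenM ?leq_addr ?leq_addl.
Qed.

Definition divisors h : seq (hike E) := [seq p.1 | p <- factor_pairs h].

Lemma divisors_uniq h : uniq (divisors h).
Proof.
rewrite map_inj_in_uniq ?factor_pairs_uniq // => -[d x] [d' y].
rewrite !mem_factor_pairs /= => /eqP <- /eqP xy dd'; congr pair => //.
by apply: (@hike_mulgI _ _ d'); rewrite /= xy dd'.
Qed.

Lemma mem_divisors h d : d \in divisors h <-> hdvd d h.
Proof.
split=> [/mapP[p + ->]|[x hE]].
  by rewrite mem_factor_pairs => /eqP <-; exists p.2.
by apply/mapP; exists (d, x) => //; rewrite mem_factor_pairs /= hE.
Qed.

Lemma hquoE d x : hquo (d * x)%g d = x.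
Proof.
apply: (@hike_mulgI _ _ d); apply/esym.
apply: (@xgetPex _ 1%g [set y | (d * x)%g = (d * y)%g]%classic).
by exists x.
Qed.

Lemma dirichletE f g h :
  dirichlet f g h = \sum_(p <- factor_pairs h) f p.1 * g p.2.
Proof.
rewrite /dirichlet.
have -> : [set d | hdvd d h]%classic = [set` divisors h]%classic.
  by apply/seteqP; split=> d /mem_divisors.
rewrite -fsbig_seq ?divisors_uniq // big_map.
apply: eq_big_seq => p; rewrite mem_factor_pairs => /eqP <-.
by rewrite hquoE.
Qed.

(** Both sides sum over the triples of product [h], enumerated without repetition in two ways. *)
Lemma dirichletA f g k :
  dirichlet (dirichlet f g) k = dirichlet f (dirichlet g k).
Proof.
apply/funext => h; rewrite !dirichletE.
under eq_bigr do rewrite dirichletE mulr_suml.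
under [RHS]eq_bigr do rewrite dirichletE mulr_sumr.
pose F (t : hike E * hike E * hike E) := f t.1.1 * g t.1.2 * k t.2.
transitivity (\sum_(t <- [seq (q.1, q.2, p.2) | p <- factor_pairs h,
    q <- factor_pairs p.1]) F t); first by rewrite big_allpairs_dep.
transitivity (\sum_(t <- [seq (p.1, q.1, q.2) | p <- factor_pairs h,
    q <- factor_pairs p.2]) F t); last first.
  rewrite big_allpairs_dep; apply: eq_bigr => p _; apply: eq_bigr => q _.
  by rewrite /F /= mulrA.
apply: perm_big; apply: uniq_perm.
- apply: allpairs_uniq_dep => [|p _|]; try exact: factor_pairs_uniq.
  move=> _ _ /allpairsPdep[p [q [ph qp ->]]]
    /allpairsPdep[p' [q' [ph' qp' ->]]].
  move: p q p' q' ph qp ph' qp' => [p1 p2] [q1 q2] [p1' p2'] [q1' q2'].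
  rewrite !mem_factor_pairs /= => _ /eqP qp _ /eqP qp' [e1 e2 e3].
  by move: qp qp'; rewrite e1 e2 e3 => <- <-.
- apply: allpairs_uniq_dep => [|p _|]; try exact: factor_pairs_uniq.
  move=> _ _ /allpairsPdep[p [q [ph qp ->]]]
    /allpairsPdep[p' [q' [ph' qp' ->]]].
  move: p q p' q' ph qp ph' qp' => [p1 p2] [q1 q2] [p1' p2'] [q1' q2'].
  rewrite !mem_factor_pairs /= => _ /eqP qp _ /eqP qp' [e1 e2 e3].
  by move: qp qp'; rewrite e1 e2 e3 => <- <-.
have mem1 x y z : ((x, y, z) \in [seq (q.1, q.2, p.2) | p <- factor_pairs h,
    q <- factor_pairs p.1]) = ((x * y * z)%g == h).
  apply/allpairsPdep/eqP => [[p [q []]]|hE].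
    by rewrite !mem_factor_pairs => /eqP <- /eqP <- [-> -> ->].
  by exists ((x * y)%g, z), (x, y); rewrite !mem_factor_pairs /= hE !eqxx.
have mem2 x y z : ((x, y, z) \in [seq (p.1, q.1, q.2) | p <- factor_pairs h,
    q <- factor_pairs p.2]) = ((x * y * z)%g == h).
  apply/allpairsPdep/eqP => [[p [q []]]|hE].
    by rewrite !mem_factor_pairs => /eqP <- /eqP <- [-> -> ->]; rewrite mulgA.
  by exists (x, (y * z)%g), (y, z); rewrite !mem_factor_pairs /= mulgA hE !eqxx.
by move=> [[x y] z]; rewrite mem1 mem2.
Qed.

Lemma factor_pairs_h1 h : (h, 1%g) \in factor_pairs h.
Proof. by rewrite mem_factor_pairs /= mulg1. Qed.

Lemma factor_pairs_1h h : (1%g, h) \in factor_pairs h.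
Proof. by rewrite mem_factor_pairs /= mul1g. Qed.

Lemma dirichlet_delta f : dirichlet f (@delta R _ E) = f.
Proof.
apply/funext => h; rewrite dirichletE.
rewrite (bigD1_seq _ (factor_pairs_h1 h) (factor_pairs_uniq h)) /=.
rewrite /delta eqxx mulr1 big1_seq ?addr0 // => -[d x] /andP[dx].
rewrite mem_factor_pairs /= => /eqP hE; case: eqP => [x1|_]; rewrite ?mulr0 //.
by move: dx; rewrite -hE x1 mulg1 eqxx.
Qed.

Lemma delta_dirichlet f : dirichlet (@delta R _ E) f = f.
Proof.
apply/funext => h; rewrite dirichletE.
rewrite (bigD1_seq _ (factor_pairs_1h h) (factor_pairs_uniq h)) /=.
rewrite /delta eqxx mul1r big1_seq ?addr0 // => -[d x] /andP[dx].
rewrite mem_factor_pairs /= => /eqP hE; case: eqP => [d1|_]; rewrite ?mul0r //.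
by move: dx; rewrite -hE d1 mul1g eqxx.
Qed.

(** Isolating the pair [(h, 1)] expresses [m h] through the values of [m] at proper divisors, which
    are strictly shorter. *)
Lemma one_fct_left_inverse : exists m : hike E -> R,
  dirichlet m (@one_fct R _ E) = @delta R _ E.
Proof.
pose L h := [seq p.1 | p <- factor_pairs h & p != (h, 1%g)].
have [|m mE] := @triangular_solution R _ (@hlen V E) L (@delta R _ E).
  move=> h x /mapP[[d y]]; rewrite mem_filter mem_factor_pairs /=.
  move=> /andP[dy /eqP hE] ->; rewrite -hE hlenM.
  suff : (0 < hlen y)%N by lia.
  rewrite lt0n hlen_eq0; apply: contra dy => /eqP y1.
  by rewrite -hE y1 mulg1.
exists m; apply/funext => h; rewrite dirichletE.
rewrite (bigD1_seq _ (factor_pairs_h1 h) (factor_pairs_uniq h)) /=.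
under eq_bigr do rewrite mulr1.
by rewrite mulr1 {1}mE big_map big_filter subrK.
Qed.

Lemma one_fct_right_inverse : exists m : hike E -> R,
  dirichlet (@one_fct R _ E) m = @delta R _ E.
Proof.
pose L h := [seq p.2 | p <- factor_pairs h & p != (1%g, h)].
have [|m mE] := @triangular_solution R _ (@hlen V E) L (@delta R _ E).
  move=> h x /mapP[[d y]]; rewrite mem_filter mem_factor_pairs /=.
  move=> /andP[dy /eqP hE] ->; rewrite -hE hlenM.
  suff : (0 < hlen d)%N by lia.
  rewrite lt0n hlen_eq0; apply: contra dy => /eqP d1.
  by rewrite -hE d1 mul1g.
exists m; apply/funext => h; rewrite dirichletE.
rewrite (bigD1_seq _ (factor_pairs_1h h) (factor_pairs_uniq h)) /=.
under eq_bigr do rewrite mul1r.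
by rewrite mul1r {1}mE big_map big_filter subrK.
Qed.

(** By associativity the left and right inverses coincide, so the set defining [mobius] is inhabited
    and the default is not taken. *)
Lemma one_fct_mobius : dirichlet (@one_fct R _ E) mobius = @delta R _ E.
Proof.
have [ml mlE] := one_fct_left_inverse; have [mr mrE] := one_fct_right_inverse.
have mlr : ml = mr.
  by rewrite -[LHS]dirichlet_delta -mrE -dirichletA mlE delta_dirichlet.
suff [] : dirichlet (@mobius R V E) (@one_fct R _ E) = @delta R _ E /\
  dirichlet (@one_fct R _ E) mobius = @delta R _ E by [].
apply: (@xgetPex _ (fun=> 0) [set m |
  dirichlet m (@one_fct R _ E) = @delta R _ E
  /\ dirichlet (@one_fct R _ E) m = @delta R _ E]%classic).
by exists ml; split=> //; rewrite mlr.
Qed.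

(** * Counting the divisors that are non-trivial walks *)

Definition walk_divisors h : seq (hike E) :=
  [seq d <- divisors h | `[< walk d /\ d <> 1%g >]].

Lemma mem_walk_divisors h d :
  d \in walk_divisors h <-> (walk d /\ d <> 1%g) /\ hdvd d h.
Proof.
rewrite mem_filter; split=> [/andP[/asboolP dw /mem_divisors //]|[dw dh]].
by apply/andP; split; [exact/asboolP|exact/mem_divisors].
Qed.

(** Induction on a factorization of length [Omega h]: by [simple_cycle_walks], its last factor
    contributes exactly one new walk. *)
Lemma size_walk_divisors h : size (walk_divisors h) = Omega h.
Proof.
have [s [<- + <-]] := OmegaP h; elim/last_ind: s => [_|s c IHs sc].
  (* The only divisor of 1 is 1, which is not a non-trivial walk. *)
  rewrite big_nil /=; case wE: (walk_divisors _) => [//|d s].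
  have /mem_walk_divisors[[_ d1] [x]] : d \in walk_divisors 1%g.
    by rewrite wE mem_head.
  move=> /(congr1 (@hlen _ _)); rewrite hlenM hlen1 => /esym/eqP.
  by rewrite addn_eq0 hlen_eq0 => /andP[/eqP].
rewrite -cats1 big_cat big_seq1 size_cat addn1 /= -IHs; last first.
  by move=> x xs; apply: sc; rewrite mem_rcons inE xs orbT.
have cc : simple_cycle c by apply: sc; rewrite mem_rcons mem_head.
have [d [dh dP]] := simple_cycle_walks (\prod_(x <- s) x)%g cc.
rewrite -[RHS]/(size (d :: walk_divisors (\prod_(x <- s) x)%g)).
apply/perm_size/uniq_perm => [||x]; rewrite /= ?filter_uniq ?divisors_uniq //.
  by rewrite andbT; apply/negP => /mem_walk_divisors[].
apply/idP/idP => [/mem_walk_divisors/dP[->|]|].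
- exact: mem_head.
- by move=> /mem_walk_divisors xs; rewrite inE xs orbT.
- by move=> /predU1P[->|/mem_walk_divisors xs];
    apply/mem_walk_divisors/dP; [left|right].
Qed.

Lemma Omega_dirichlet : (fun h => (Omega h)%:R) =
  dirichlet (@nontrivial_walk_ind R _ E) (@one_fct R _ E).
Proof.
apply/funext => h; rewrite dirichletE -size_walk_divisors size_filter.
rewrite -sum1_count big_mkcond natr_sum big_map; apply: eq_bigr => p _.
by rewrite mulr1 /nontrivial_walk_ind; case: `[< _ >].
Qed.
End DirichletTheory.

Theorem corollary3p6 (R : realType) (V : finType) (E : {set V * V})
    (h : hike E) :
  dirichlet (fun x => (Omega x)%:R%R) mobius h = nontrivial_walk_ind R h.
Proof.
by rewrite Omega_dirichlet dirichletA one_fct_mobius dirichlet_delta.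
Qed.
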